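(* Let $\mathcal{X}$ and $\mathcal{Y}$ be two paired real vector spaces with bilinear form $\langle\cdot,\cdot\rangle$, let $\mathcal{W}$ be a set, let $\theta:\mathcal{W}\to\mathcal{X}$ be a mapping, and let $c_\theta(w,y)=\langle\theta(w),y\rangle$ for $(w,y)\in\mathcal{W}\times\mathcal{Y}$. A function $h:\mathcal{W}\to\overline{\mathbb{R}}$ is $c_\theta$-convex if and only if it is the composition of a closed convex function $f:\mathcal{X}\to\overline{\mathbb{R}}$ with the mapping $\theta$. More precisely, for any function $h:\mathcal{W}\to\overline{\mathbb{R}}$ the following are equivalent: (a) $h$ is $c_\theta$-convex; (b) $h=h^{c_\theta c_\theta'}$; (c) $h=(h^{c_\theta})^{\star'}\circ\theta$ (where $(h^{c_\theta})^{\star'}:\mathcal{X}\to\overline{\mathbb{R}}$ is a closed convex function); (d) there exists a closed convex function $f:\mathcal{X}\to\overline{\mathbb{R}}$ such that $h=f\circ\theta$.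
   Context: $\overline{\mathbb{R}}=[-\infty,+\infty]$. $\mathcal{X}$ and $\mathcal{Y}$ are paired: there are a bilinear form $\langle\cdot,\cdot\rangle:\mathcal{X}\times\mathcal{Y}\to\mathbb{R}$ and locally convex topologies on $\mathcal{X}$ and $\mathcal{Y}$ such that the continuous linear forms on $\mathcal{X}$ are exactly $x\mapsto\langle x,y\rangle$, $y\in\mathcal{Y}$, and those on $\mathcal{Y}$ are exactly $y\mapsto\langle x,y\rangle$, $x\in\mathcal{X}$. A function is convex if its epigraph is convex, and closed if it is either lower semicontinuous and nowhere equal to $-\infty$, or is the constant function $-\infty$. (So closed convex functions are the constants $-\infty$, $+\infty$ and the proper convex lower semicontinuous functions.) For $g:\mathcal{Y}\to\overline{\mathbb{R}}$, $g^{\star'}(x)=\sup_{y\in\mathcal{Y}}(\langle x,y\rangle-g(y))$ for $x\in\mathcal{X}$. For $h:\mathcal{W}\to\overline{\mathbb{R}}$, $h^{c_\theta}(y)=\sup_{w\in\mathcal{W}}(c_\theta(w,y)-h(w))$; for $g:\mathcal{Y}\to\overline{\mathbb{R}}$, $g^{c_\theta'}(w)=\sup_{y\in\mathcal{Y}}(c_\theta(w,y)-g(y))$; $h^{c_\theta c_\theta'}=(h^{c_\theta})^{c_\theta'}$. By definition $h$ is $c_\theta$-convex if it equals its $c_\theta$-biconjugate $h^{c_\theta c_\theta'}$. *)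

(* Defs.v *)
From HB Require Import structures.
From mathcomp Require Import all_boot all_order all_algebra.
From mathcomp Require Import sesquilinear.
From mathcomp Require Import boolp classical_sets functions reals ereal convex.
From mathcomp Require Import topology normedtype.

Set Implicit Arguments.
Unset Strict Implicit.
Unset Printing Implicit Defensive.

Import Order.TTheory GRing.Theory Num.Theory.
Import numFieldNormedType.Exports.

Local Open Scope classical_set_scope.
Local Open Scope ring_scope.

(* A topology of type [tvsType R] is locally convex but not necessarily
   Hausdorff; accordingly the pairing is not required to separate points. *)
Definition paired (R : realType) (X Y : tvsType R)
    (B : {bilinear X -> Y -> R | *%R & *%R}) : Prop :=
  (forall l : X -> R,
      scalar l /\ continuous l <-> exists y : Y, l = (fun x => B x y)) /\
  (forall l : Y -> R,
      scalar l /\ continuous l <-> exists x : X, l = (fun y => B x y)).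

Definition epigraph (R : realType) (X : Type) (f : X -> \bar R) :
    set (X * R^o) :=
  [set p | (f p.1 <= (p.2 : R)%:E)%E].

Definition convex_efun (R : realType) (X : lmodType R) (f : X -> \bar R) :
    Prop :=
  convex_set (epigraph f).

Definition closed_efun (R : realType) (X : topologicalType)
    (f : X -> \bar R) : Prop :=
  (lower_semicontinuous f /\ forall x, f x <> -oo%E) \/ f = cst -oo%E.

Definition closed_convex (R : realType) (X : tvsType R) (f : X -> \bar R) :
    Prop :=
  closed_efun f /\ convex_efun f.

(* [r%:E - z] with [r] finite never meets an indeterminate [+oo - +oo], and
   [ereal_sup set0 = -oo]. *)
Definition c_conj (R : realType) (W Y : Type) (c : W -> Y -> R)
    (h : W -> \bar R) (y : Y) : \bar R :=
  ereal_sup (range (fun w : W => (c w y)%:E - h w)%E).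

Definition c_conj' (R : realType) (W Y : Type) (c : W -> Y -> R)
    (g : Y -> \bar R) (w : W) : \bar R :=
  ereal_sup (range (fun y : Y => (c w y)%:E - g y)%E).

Definition c_biconj (R : realType) (W Y : Type) (c : W -> Y -> R)
    (h : W -> \bar R) : W -> \bar R :=
  c_conj' c (c_conj c h).

Definition c_convex (R : realType) (W Y : Type) (c : W -> Y -> R)
    (h : W -> \bar R) : Prop :=
  h = c_biconj c h.

Definition star' (R : realType) (X Y : tvsType R)
    (B : {bilinear X -> Y -> R | *%R & *%R}) (g : Y -> \bar R) (x : X) :
    \bar R :=
  ereal_sup (range (fun y : Y => (B x y)%:E - g y)%E).

Definition c_theta (R : realType) (X Y : tvsType R)
    (B : {bilinear X -> Y -> R | *%R & *%R}) (W : Type) (theta : W -> X)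
    (w : W) (y : Y) : R :=
  B (theta w) y.

(* Main.v *)
Require Import Defs.
From HB Require Import structures.
From mathcomp Require Import all_boot all_order all_algebra.
From mathcomp Require Import sesquilinear.
From mathcomp Require Import boolp classical_sets functions reals ereal convex.
From mathcomp Require Import topology normedtype.
From mathcomp Require Import interval_inference lra.

(** The substance is the Fenchel-Moreau theorem: a closed convex function [f]
    with no value [-oo] is the supremum of its continuous affine minorants, so
    [f \o theta] is the supremum of the [c_theta]-affine functions below it.
    Near a point [x1], lower semicontinuity puts [f] above a level [M] on a
    neighbourhood [x1 + U]; away from it, convexity (if [f x1] is finite) or an
    affine minorant already found puts [f] above [M - K s] on [x1 + s U].
    Sandwiching a linear form between this cone and [f] is the algebraic
    Hahn-Banach theorem, and the form is continuous because it is bounded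
    above by [K] on the symmetric neighbourhood [U]. *)

Set Implicit Arguments.
Unset Strict Implicit.
Unset Printing Implicit Defensive.

Import Order.TTheory GRing.Theory Num.Theory.
Import numFieldNormedType.Exports.

Local Open Scope classical_set_scope.
Local Open Scope ring_scope.

(** * Linear forms *)

Section scalar_functions.
Context (R : realType) (V : lmodType R) (l : V -> R).
Hypothesis l_lin : scalar l.

Lemma scalar_funD x y : l (x + y) = l x + l y.
Proof. by have := l_lin 1 x y; rewrite scale1r /= mul1r. Qed.

Lemma scalar_fun0 : l 0 = 0.
Proof. by apply: (addrI (l 0)); rewrite -scalar_funD !addr0. Qed.

Lemma scalar_funZ t x : l (t *: x) = t * l x.
Proof. by have := l_lin t x 0; rewrite !addr0 scalar_fun0 addr0. Qed.

Lemma scalar_funB x y : l (x - y) = l x - l y.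
Proof. by rewrite scalar_funD -scaleN1r scalar_funZ mulN1r. Qed.

End scalar_functions.

(** * Algebraic Hahn-Banach theorem, in terms of cones *)

Section hahn_banach.
Context (R : realType) (V : lmodType R).
Implicit Types C D : set (V * R^o).

(** The condition over [0] bounds the fibre over [x] below as soon as the fibre over [- x] is
    nonempty. *)
Definition nonneg_fiber_cone C :=
  [/\ forall p q, C p -> C q -> C (p + q),
      forall t p, 0 <= t -> C p -> C (t *: p)
    & forall a, C (0, a) -> 0 <= a].

Lemma maximal_nonneg_fiber_cone C : nonneg_fiber_cone C ->
  exists D, [/\ C `<=` D, nonneg_fiber_cone D &
    forall E, D `<=` E -> nonneg_fiber_cone E -> E `<=` D].
Proof.
(* Zorn's lemma is applied to [D] with [C] adjoined, so that the empty chain, whose union is empty,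
   is admissible and the maximal cone still contains [C]. *)
move=> Ccone; pose P := [set D | nonneg_fiber_cone (C `|` D)].
have [F FP Ftot|D [PD maxD]] := @Zorn_bigcup _ P.
  have pick1 p : (C `|` \bigcup_(X in F) X) p ->
      exists2 D, D = set0 \/ F D & (C `|` D) p.
    case=> [Cp|[D FD Dp]]; first by exists set0; left.
    by exists D; right.
  have inU D p : D = set0 \/ F D -> (C `|` D) p ->
      (C `|` \bigcup_(X in F) X) p.
    move=> FD [Cp|Dp]; [by left|right].
    by case: FD Dp => [->//|FD Dp]; exists D.
  have PU D : D = set0 \/ F D -> P D.
    by case=> [->|/FP//]; rewrite /P/= setU0.
  split=> [p q /pick1[D FD Dp] /pick1[E FE Eq]|t p t0 /pick1[D FD Dp]|
           a /pick1[D FD Da]].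
  - have [DE|ED] : D `<=` E \/ E `<=` D.
      case: FD => [->|FD]; first by left; exact: sub0set.
      case: FE => [->|FE]; first by right; exact: sub0set.
      exact: Ftot.
    + have [addE _ _] := PU _ FE; apply: (inU E) => //; apply: addE => //.
      exact: setUS Dp.
    + have [addD _ _] := PU _ FD; apply: (inU D) => //; apply: addD => //.
      exact: setUS Eq.
  - have [_ scaleD _] := PU _ FD; apply: (inU D) => //; exact: scaleD.
  - by have [_ _ +] := PU _ FD; exact.
exists (C `|` D); split=> // E CDE Econe.
have CE : C `|` E = E.
  by apply: setUidr; apply: subset_trans CDE; exact: subsetUl.
have DE : D `<=` E by apply: subset_trans CDE; exact: subsetUr.
have [ED|nED] := pselect (E `<=` D).
  by apply: subset_trans ED _; exact: subsetUr.
by exfalso; apply: (maxD E); [split|rewrite /P/= CE].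
Qed.

(* [C] plays the role of the epigraph of a sublinear function; for a maximal
   cone [D] above it, [l x] is the least [a] with [D (x, a)]. *)
Lemma hahn_banach_cone C : nonneg_fiber_cone C ->
  (forall x, exists a, C (x, a)) ->
  exists2 l : V -> R, scalar l & forall x a, C (x, a) -> l x <= a.
Proof.
move=> /maximal_nonneg_fiber_cone[D [CD [addD scaleD posD] maxD]] Ctot.
have Dtot x : exists a, D (x, a) by have [a /CD] := Ctot x; exists a.
have D0 x a b : D (x, a) -> D (- x, b) -> 0 <= a + b.
  by move=> Da Db; apply: posD; rewrite -(subrr x); exact: addD Da Db.
have Dmax x a : (forall b, D (- x, b) -> 0 <= a + b) -> D (x, a).
  move=> xa.
  have D00 : D 0 by have [d /(scaleD 0)] := Dtot 0; rewrite scale0r; exact.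
  (* Adjoin to [D] the ray through [(x, a)]; the assumption on [a] is what keeps the fibre of [E]
     over [0] nonnegative, so maximality applies. *)
  pose E := [set p | exists q t,
    [/\ D q, 0 <= t & p = q + t *: ((x, a) : V * R^o)]].
  have DE : D `<=` E by move=> p Dp; exists p, 0; rewrite scale0r addr0.
  have xaE : E (x, a) by exists 0, 1; rewrite scale1r add0r.
  apply: (maxD E) => //; split.
  - move=> _ _ [q [t [Dq t0 ->]]] [q' [t' [Dq' t'0 ->]]].
    exists (q + q'), (t + t'); rewrite scalerDl addrACA addr_ge0//; split=> //.
    exact: addD.
  - move=> s _ s0 [q [t [Dq t0 ->]]].
    exists (s *: q), (s * t); rewrite scalerDr scalerA mulr_ge0//; split=> //.
    exact: scaleD.
  - move=> b [[y c] [t [Dyc t0 [/= y0 ->]]]].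
    case: (eqVneq t 0) y0 => [->|tn0] y0.
      rewrite scale0r addr0; apply: posD.
      by move: y0; rewrite scale0r addr0 => ->.
    have t1 : 0 < t by rewrite lt_neqAle eq_sym tn0.
    have yE : y = - (t *: x) by apply/eqP; rewrite -addr_eq0 -y0.
    have := xa (t^-1 * c); rewrite -(pmulr_rge0 _ t1) mulrDr mulVKf//.
    rewrite addrC; apply.
    have : D (t^-1 *: ((y, c) : V * R^o)).
      by apply: scaleD => //; rewrite invr_ge0.
    by congr D; congr pair; rewrite yE /= scalerN scalerA mulVf// scale1r.
pose l x := inf [set a | D (x, a)].
have lle x a : D (x, a) -> l x <= a.
  move=> Dxa; apply: ge_inf => //; have [b Db] := Dtot (- x).
  by exists (- b) => c /= Dc; rewrite -subr_ge0 opprK; exact: D0 Dc Db.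
have lge x a : (forall b, D (x, b) -> a <= b) -> a <= l x.
  by move=> xa; apply: lb_le_inf => //; have [b Db] := Dtot x; exists b.
have Dl x : D (x, l x).
  apply: Dmax => b Db; rewrite -[b]opprK subr_ge0; apply: lge => c Dc.
  by rewrite -subr_ge0 opprK; exact: D0 Dc Db.
(* Maximality makes [l] odd; a subadditive odd function is additive. *)
have lN x : l (- x) = - l x.
  apply/eqP; rewrite eq_le; apply/andP; split; last first.
    by rewrite -subr_ge0 opprK addrC; exact: D0 (Dl x) (Dl (- x)).
  rewrite lerNr; apply: (lle); apply: Dmax => b /lle.
  by rewrite addrC subr_ge0.
have lD x y : l (x + y) = l x + l y.
  have sub u v : l (u + v) <= l u + l v.
    by apply: lle; exact: addD (Dl u) (Dl v).
  apply/eqP; rewrite eq_le sub/=.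
  by have := sub (- x) (- y); rewrite -opprD !lN -opprD lerN2.
have l0 : l 0 = 0 by apply: (addrI (l 0)); rewrite -lD !addr0.
have lZpos t x : 0 < t -> l (t *: x) = t * l x.
  move=> t0; have sub s u : 0 < s -> l (s *: u) <= s * l u.
    by move=> s0; apply: lle; exact: scaleD (ltW s0) (Dl u).
  apply/eqP; rewrite eq_le sub//=.
  have := sub t^-1 (t *: x); rewrite invr_gt0 => /(_ t0).
  by rewrite scalerA mulVf ?gt_eqF// scale1r ler_pdivlMl.
exists l => [t x y|x a /CD]; last exact: lle.
rewrite lD; congr (_ + _).
have [t0|t0|->] := ltrgtP t 0; last by rewrite !scale0r l0 /= mul0r.
- by rewrite -[t *: x]opprK -scaleNr lN lZpos ?oppr_gt0// mulNr opprK.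
- exact: lZpos.
Qed.

End hahn_banach.

(** * Convex sets and the sandwich theorem *)

Section convexity.
Context (R : realType).

(** Divide the weights by [s + t]; if both vanish, any point of [A] serves. *)
Lemma convex_set_cone (V : lmodType R) (A : set V) x y (s t : R) :
  convex_set A -> A x -> A y -> 0 <= s -> 0 <= t ->
  exists2 z, A z & s *: x + t *: y = (s + t) *: z.
Proof.
move=> cA Ax Ay s0 t0; have [st0|st0] := eqVneq (s + t) 0.
  have [s00 t00] : s = 0 /\ t = 0 by split; lra.
  by exists x; rewrite // st0 s00 t00 !scale0r addr0.
have stpos : 0 < s + t by rewrite lt_neqAle eq_sym st0 addr_ge0.
have p0 : 0 <= s / (s + t) by rewrite divr_ge0// ltW.
have p1 : s / (s + t) <= 1 by rewrite ler_pdivrMr// mul1r lerDl.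
exists (conv (Itv01 p0 p1) (x : convex_lmodType V) (y : convex_lmodType V)).
  by apply/set_mem/cA; exact/mem_set.
rewrite [conv _ _ _]/((s / (s + t)) *: x + (1 - s / (s + t)) *: y).
rewrite scalerDr !scalerA mulrBr mulr1 mulrCA divff// mulr1.
by rewrite [s + t]addrC addrK.
Qed.

Lemma convex_set_conv (V : lmodType R) (A : set V) x y (s t : R) :
  convex_set A -> A x -> A y -> 0 <= s -> 0 <= t -> s + t = 1 ->
  A (s *: x + t *: y).
Proof.
move=> cA Ax Ay s0 t0 st1.
by have [z Az ->] := convex_set_cone cA Ax Ay s0 t0; rewrite st1 scale1r.
Qed.

Lemma convex_setP (V : lmodType R) (A : set V) :
  (forall x y (s t : R), A x -> A y -> 0 <= s -> 0 <= t -> s + t = 1 ->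
    A (s *: x + t *: y)) -> convex_set A.
Proof.
move=> cA x y p /set_mem Ax /set_mem Ay; apply/mem_set.
by apply: (cA x y p%:num (1 - p%:num) Ax Ay); rewrite ?subr_ge0 ?subrKC.
Qed.

Definition absorbing (V : lmodType R) (U : set V) :=
  forall x, exists t u, [/\ 0 <= t, U u & x = t *: u].

(** Apply [hahn_banach_cone] to the cone generated by [E] and [U × {K}]: the first generator yields
    the bound on [E], the second the bound on [U]. Absorption makes every fibre nonempty, and the
    last hypothesis makes the fibre over [0] nonnegative. *)
Lemma sandwich (V : lmodType R) (E : set (V * R^o)) (U : set V) (K : R) :
  convex_set E -> convex_set U -> absorbing U ->
  (forall u, U u -> U (- u)) -> 0 <= K ->
  (forall u s g, U u -> 0 <= s -> E (s *: u, g) -> - (K * s) <= g) ->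
  exists l : V -> R, [/\ scalar l, forall x g, E (x, g) -> l x <= g &
    forall u, U u -> l u <= K].
Proof.
move=> cE cU absU symU K0 KE.
(* Elements of [C] involve a point of [E], so an empty [E] is treated apart, with the zero form. *)
have [[p0 Ep0]|E0] := pselect (exists p, E p); last first.
  exists (fun=> 0); split=> // [a x y|x g Exg]; first by rewrite /= mulr0 addr0.
  by exfalso; apply: E0; exists (x, g).
pose C := [set q : V * R^o | exists p u t s,
  [/\ E p, U u, 0 <= t, 0 <= s & q = t *: p + s *: ((u, K) : V * R^o)]].
have CE p : E p -> C p.
  move=> Ep; have [_ [u [_ Uu _]]] := absU 0.
  by exists p, u, 1, 0; rewrite scale1r scale0r addr0.
have CU s u : 0 <= s -> U u -> C (s *: ((u, K) : V * R^o)).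
  by move=> s0 Uu; exists p0, u, 0, s; rewrite scale0r add0r.
have [||l l_lin lC] := @hahn_banach_cone _ _ C.
- split=> [_ _ [p [u [t [s [Ep Uu t0 s0 ->]]]]]
               [p' [u' [t' [s' [Ep' Uu' t'0 s'0 ->]]]]]
          |r _ r0 [p [u [t [s [Ep Uu t0 s0 ->]]]]]
          |a [[y g] [u [t [s [Ep Uu t0 s0 [/= y0 ->]]]]]]].
  + have [p2 Ep2 pE] := convex_set_cone cE Ep Ep' t0 t'0.
    have [u2 Uu2 uE] := convex_set_cone cU Uu Uu' s0 s'0.
    exists p2, u2, (t + t'), (s + s'); split; rewrite ?addr_ge0//.
    rewrite addrACA pE; congr (_ + _); congr pair => //=.
    by rewrite -mulrDl.
  + exists p, u, (r * t), (r * s).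
    by rewrite !mulr_ge0// scalerDr !scalerA; split.
  + have [t00|tn0] := eqVneq t 0.
      by rewrite t00 scale0r add0r mulr_ge0.
    have t1 : 0 < t by rewrite lt_neqAle eq_sym tn0.
    (* A vanishing first coordinate means [t *: y = - (s *: u)], so the compatibility hypothesis can
       be used at [- u]. *)
    have yE : y = (t^-1 * s) *: (- u).
      rewrite scalerN -scalerN -scalerA scalerN.
      apply: (scalerI tn0); rewrite scalerA divff// scale1r.
      by apply/eqP; rewrite -addr_eq0 -y0.
    have := KE (- u) (t^-1 * s) g (symU _ Uu).
    rewrite mulr_ge0 ?invr_ge0// -yE => /(_ isT Ep).
    rewrite -(ler_pM2l t1) mulrN mulrCA mulVKf// -subr_ge0 opprK.
    by rewrite [K * s]mulrC.
- move=> x; have [t [u [t0 Uu ->]]] := absU x.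
  by exists (t * K); exact: CU.
exists l; split => // [x g Exg|u Uu]; first by apply: lC; exact: CE.
by apply: lC; have := CU 1 u ler01 Uu; rewrite scale1r.
Qed.

End convexity.

(** * Neighbourhoods and continuity in locally convex spaces *)

Section tvs.
Context (R : realType) (X : tvsType R).

(** Intersect a convex open neighbourhood of [0] with its opposite; it absorbs [x] because scaling
    is continuous at [(0, x)]. *)
Lemma convex_symmetric_nbhs (x0 : X) (V : set X) : nbhs x0 V ->
  exists U, [/\ nbhs 0 U, convex_set U, absorbing U,
    forall u, U u -> U (- u) & forall u, U u -> V (x0 + u)].
Proof.
move=> /(nbhsB (- x0)); rewrite addNr => V0.
have [B Bconv [Bopen /(_ 0 _ V0)[b [Bb b0] bV]]] := @locally_convex R X.
have nb : nbhs 0 b by apply: open_nbhs_nbhs; split => //; exact: Bopen.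
have nU : nbhs 0 (b `&` -%R @` b) by apply: filterI => //; exact: nbhs0N.
exists (b `&` -%R @` b); split=> //.
- apply: convex_setP => x y s t [bx [x' bx' xE]] [yx [y' by' yE]] s0 t0 st1.
  have cb : convex_set b by apply: Bconv; exact/mem_set.
  split; first exact: convex_set_conv.
  exists (s *: x' + t *: y'); first exact: convex_set_conv.
  by rewrite opprD -!scalerN xE yE.
- move=> x.
  have := @scale_continuous R X (0, x) (b `&` -%R @` b).
  rewrite /= scale0r => /(_ nU)[[T S] [/= T0 Sx] TSb].
  have /nbhs_ballP[e /= e0 eT] := T0.
  have e2 : 0 < e / 2 by rewrite divr_gt0.
  exists (e / 2)^-1, ((e / 2) *: x); split; first by rewrite invr_ge0 ltW.
    apply: (TSb (e / 2, x)); split => /=; last exact: nbhs_singleton.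
    apply: eT; rewrite -ball_normE /= sub0r normrN gtr0_norm//.
    by rewrite ltr_pdivrMr// ltr_pMr// ltr1n.
  by rewrite scalerA mulVf ?gt_eqF// scale1r.
- move=> u [bu [u' bu' u'E]]; rewrite -u'E opprK; split => //.
  by exists u; rewrite // -u'E opprK.
- by move=> u [/bV[v Vv <-] _]; rewrite addNKr.
Qed.

(** By symmetry [|l| <= K] on [U], hence [|l| < e] on [U] scaled by [e / (K + 1)]; the added [1]
    covers [K = 0]. *)
Lemma scalar_continuous (l : X -> R) (U : set X) (K : R) : scalar l ->
  nbhs 0 U -> (forall u, U u -> U (- u)) -> (forall u, U u -> l u <= K) ->
  continuous l.
Proof.
move=> l_lin U0 symU lK.
have lD := scalar_funD l_lin; have lZ := scalar_funZ l_lin.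
move=> x; apply/cvgrPdist_lt => e e0.
have K0 : 0 <= K.
  by rewrite -(scalar_fun0 l_lin); apply: lK; exact: nbhs_singleton.
have K1 : 0 < K + 1 by rewrite ltr_wpDl.
have d0 : e / (K + 1) != 0 by rewrite gt_eqF// divr_gt0.
have := nbhsT x (nbhs0Z d0 U0); apply: filterS => _ [_ [u Uu <-] <-].
rewrite lD lZ opprD addNKr normrN normrM gtr0_norm ?divr_gt0//.
rewrite -mulrA gtr_pMr// ltr_pdivrMl// mulr1.
apply: (@le_lt_trans _ _ K); last by rewrite ltrDl.
rewrite ler_norml lK// lerNl andbT -mulN1r -lZ scaleN1r; exact/lK/symU.
Qed.

End tvs.

(** * Continuous affine minorants of a convex function *)

Section affine_minorants.
Context (R : realType) (X : tvsType R) (f : X -> \bar R).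
Hypothesis cf : convex_efun f.

Let epi_conv x y (a b s t : R) : (f x <= a%:E)%E -> (f y <= b%:E)%E ->
  0 <= s -> 0 <= t -> s + t = 1 ->
  (f (s *: x + t *: y)%R <= (s * a + t * b)%:E)%E.
Proof.
by move=> fx fy; apply: (convex_set_conv (x := (x, a)) (y := (y, b)) cf).
Qed.

(** Apply [sandwich] to the epigraph of [f] with [(x0, c)] moved to the origin. For [s <= 1] the
    point [s *: u] stays in [U], where the level [c] suffices; for [s >= 1] the cone bound is
    assumed. *)
Lemma affine_minorant_at (U : set X) (x0 : X) (c K : R) :
  nbhs 0 U -> convex_set U -> absorbing U -> (forall u, U u -> U (- u)) ->
  0 <= K -> (forall u, U u -> (c%:E <= f (x0 + u)%R)%E) ->
  (forall u s, U u -> 1 <= s -> ((c - K * s)%:E <= f (x0 + s *: u)%R)%E) ->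
  exists l : X -> R, [/\ scalar l, continuous l &
    forall x, ((c + l (x - x0))%:E <= f x)%E].
Proof.
move=> U0 cU absU symU K0 fU fsU.
have [||l [l_lin lE lU]] := @sandwich R X
    [set p | (f (x0 + p.1)%R <= (p.2 + c : R)%:E)%E] U K _ cU absU symU K0.
- apply: convex_setP => -[x a] [y b] s t /= fx fy s0 t0 st1.
  have := epi_conv fx fy s0 t0 st1.
  rewrite !scalerDr addrACA -scalerDl st1 scale1r => /le_trans; apply.
  by rewrite lee_fin !mulrDr addrACA -mulrDl st1 mul1r.
- move=> u s g Uu s0 /= fg; rewrite -subr_ge0 opprK.
  have [s1|s1] := leP s 1.
    suff : (c%:E <= (g + c)%:E)%E.
      by rewrite lee_fin lerDr => g0; rewrite addr_ge0 ?mulr_ge0.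
    apply: le_trans fg; apply: fU.
    have := convex_set_conv cU Uu (nbhs_singleton U0) s0.
    by move=> /(_ (1 - s)); rewrite scaler0 addr0 subr_ge0 subrKC; exact.
  have := le_trans (fsU _ _ Uu (ltW s1)) fg.
  by rewrite lee_fin lerBlDr addrAC lerDr.
exists l; split=> // [|x]; first exact: scalar_continuous lU.
case fx : (f x) => [r| |]; last first.
(* The value [-oo] would put every height in the fibre, even one below [l]. *)
- have /= := lE (x - x0) (l (x - x0) - 1); rewrite subrKC fx leNye => /(_ isT).
  by rewrite lerBrDr gerDl ler10.
- by rewrite leey.
- rewrite lee_fin -lerBrDl; apply: lE => /=.
  by rewrite subrKC fx subrK.
Qed.

Hypothesis lf : lower_semicontinuous f.

(** A first minorant, which later controls [f] far from an arbitrary point. Finiteness of [f x0]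
    lets convexity carry the local bound [r - 1] outwards with slope [1]. *)
Let affine_minorant_dom x0 (r : R) : f x0 = r%:E ->
  exists l c, [/\ scalar l, continuous (l : X -> R) &
    forall x, ((l x - c)%:E <= f x)%E].
Proof.
move=> fx0; have [|V V0 Vf] := lf (x := x0) (a := r - 1).
  by rewrite fx0 lte_fin ltrBlDr ltrDl.
have [U [U0 cU absU symU UV]] := convex_symmetric_nbhs V0.
have fU u : U u -> ((r - 1)%:E < f (x0 + u)%R)%E by move=> /UV/Vf.
have [|u Uu|u s Uu s1|l [l_lin l_cont lf']] :=
    @affine_minorant_at U x0 (r - 1) 1 U0 cU absU symU.
- by [].
- exact/ltW/fU.
- have s0 : 0 < s by apply: lt_le_trans s1.
  rewrite leNgt; apply/negP => flt.
  have := fU _ Uu.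
  (* A value below [r - 1 - s] at [x0 + s *: u] would give at most [r - 1 - s^-1] at [x0 + u],
     against [fU]. *)
  have -> : x0 + u = (1 - s^-1) *: x0 + s^-1 *: (x0 + s *: u).
    rewrite scalerDr scalerA mulVf ?gt_eqF// scale1r addrA -scalerDl subrK.
    by rewrite scale1r.
  apply/negP; rewrite -leNgt.
  have s'1 : 0 <= 1 - s^-1 by rewrite subr_ge0 invf_le1.
  have s'0 : 0 <= s^-1 by rewrite invr_ge0 ltW.
  have fx0' : (f x0 <= r%:E)%E by rewrite fx0.
  apply: le_trans (epi_conv fx0' (ltW flt) s'1 s'0 (subrK _ _)) _.
  rewrite lee_fin mul1r mulrBl mulrBr mulrBr mul1r mulVf ?gt_eqF// mulr1.
  lra.
exists l, (l x0 - (r - 1)); split=> // x; apply: le_trans (lf' x).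
by rewrite lee_fin (scalar_funB l_lin); lra.
Qed.

Hypothesis f_gtNy : forall x, f x <> -oo%E.

(** Since [f x1] may be [+oo], the bound far from [x1] comes from a minorant built at a point of
    finite value. *)
Lemma affine_minorant x1 (M : R) : (M%:E < f x1)%E ->
  exists l c, [/\ scalar l, continuous (l : X -> R),
    forall x, ((l x - c)%:E <= f x)%E & M <= l x1 - c].
Proof.
move=> Mf.
(* Without finite values [f] is constantly [+oo], and the constant [M] is a minorant. *)
have [[x0 [r fx0]]|nfin] := pselect (exists x r, f x = r%:E); last first.
  exists (fun=> 0), (- M); split=> [a x y| |x|]; rewrite ?sub0r ?opprK//=.
  - by rewrite mulr0 addr0.
  - exact: cst_continuous.
  - case fx : (f x) => [r| |]; rewrite ?leey//; last by have := f_gtNy fx.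
    by exfalso; apply: nfin; exists x, r.
have [l [c [l_lin l_cont lcf]]] := affine_minorant_dom fx0.
have lD := scalar_funD l_lin.
have [V Vx1 Vf] := lf Mf.
have /cvgrPdist_lt/(_ 1 ltr01) W := l_cont x1.
have [U [U0 cU absU symU UVW]] := convex_symmetric_nbhs (filterI Vx1 W).
(* The [1] absorbs [s * l u >= - s]; the absolute value, multiplied by [s >= 1], absorbs the gap at
   [x1] between [M] and the minorant. *)
pose K := 1 + `|M - (l x1 - c)|.
have [|u Uu|u s Uu s1|l' [l'_lin l'_cont l'f]] :=
    @affine_minorant_at U x1 M K U0 cU absU symU.
- by rewrite addr_ge0.
- by have [/Vf/ltW] := UVW _ Uu.
- apply: le_trans (lcf _); rewrite lee_fin lD (scalar_funZ l_lin).
  have [_ /=] := UVW _ Uu; rewrite lD opprD addNKr normrN => lu.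
  have s0 : 0 <= s by apply: le_trans s1.
  have lu1 : - s <= s * l u.
    rewrite -mulrN1 ler_wpM2l//; move: lu; rewrite ltr_norml => /andP[+ _].
    exact: ltW.
  have Ms : `|M - (l x1 - c)| <= `|M - (l x1 - c)| * s by rewrite ler_peMr.
  have := ler_norm (M - (l x1 - c)).
  rewrite /K mulrDl mul1r; lra.
exists l', (l' x1 - M); split=> // [x|]; last lra.
apply: le_trans (l'f x).
by rewrite lee_fin (scalar_funB l'_lin); lra.
Qed.

End affine_minorants.

(** * Conjugates and biconjugates *)

Lemma c_biconj_le (R : realType) (W Y : Type) (c : W -> Y -> R)
  (h : W -> \bar R) w : (c_biconj c h w <= h w)%E.
Proof.
apply: ge_ereal_sup => _ [y _ <-].
have : ((c w y)%:E - h w <= c_conj c h y)%E.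
  by apply: ereal_sup_ubound; exists w.
case: (h w) => [r| |]; rewrite ?leey//;
  case: (c_conj c h y) => [q| |]//=; last by rewrite leNye.
by rewrite !lee_fin; lra.
Qed.

Section paired_spaces.
Context (R : realType) (X Y : tvsType R)
  (B : {bilinear X -> Y -> R | *%R & *%R}).
Hypothesis XY_paired : paired B.

(** A supremum of continuous affine functions, with constants [+oo] or [-oo] where [g] is infinite.
    It takes the value [-oo] only if [g] is constantly [+oo], and is then constant. *)
Lemma star'_closed_convex (g : Y -> \bar R) : closed_convex (star' B g).
Proof.
split.
- have [goo|/existsNP[y0 gy0]] := pselect (forall y, g y = +oo%E).
    right; apply/funext => x /=; apply/ereal_sup_ninfty => _ [y _ <-] /=.
    by rewrite goo.
  left; split=> [x a|x].
    move=> /ereal_sup_gt[_ [y _ <-] ay].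
    have [_ By] : scalar (fun x => B x y) /\ continuous (fun x => B x y).
      by apply/(XY_paired.1 _).2; exists y.
    move: ay; case gy : (g y) => [r| |] //= ay.
    + exists [set x | (a + r < B x y)%R].
        apply: (By x [set t : R | (a + r < t)%R]).
        apply: open_nbhs_nbhs; split; first exact: open_gt.
        by move: ay; rewrite lte_fin ltrBrDr.
      move=> z /= arz.
      apply: lt_le_trans (ereal_sup_ubound _); last by exists y.
      by rewrite gy lte_fin ltrBrDr.
    + exists setT => [|z _]; first exact: filterT.
      apply: lt_le_trans (ereal_sup_ubound _); last by exists y.
      by rewrite gy ltey.
  move=> /ereal_sup_ninfty/(_ ((B x y0)%:E - g y0)%E) /=.
  move=> /(_ (ex_intro2 _ _ y0 I erefl)).
  by case: (g y0) gy0.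
- apply: convex_setP => -[x a] [x' a'] s t.
  rewrite /epigraph /= => fx fx' s0 t0 st1.
  apply: ge_ereal_sup => _ [y _ <-].
  have : ((B x y)%:E - g y <= a%:E)%E.
    by apply: le_trans fx; apply: ereal_sup_ubound; exists y.
  have : ((B x' y)%:E - g y <= a'%:E)%E.
    by apply: le_trans fx'; apply: ereal_sup_ubound; exists y.
  case: (g y) => [r| |] //=; last by rewrite !leNye.
  rewrite !lee_fin linearDl !linearZl_LR /=.
  have comb (u v b b' : R) : v - r <= b' -> u - r <= b ->
      s * u + t * v - r <= s * b + t * b'.
    move=> vb ub; have := lerD (ler_wpM2l s0 ub) (ler_wpM2l t0 vb).
    by rewrite !mulrBr addrACA -opprD -mulrDl st1 mul1r.
  exact: comb.
Qed.

Context (W : Type) (theta : W -> X) (h : W -> \bar R).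
Let c := c_theta B theta.

(** Otherwise a real [M] separates the two values, and some affine minorant [l - s] of [f] reaches
    [M] at [theta w]. The pairing represents [l] by some [y]; then the conjugate at [y] is at most
    [s], which lifts the biconjugate at [w] to [M]. *)
Lemma le_c_biconj (f : X -> \bar R) : closed_convex f -> h = f \o theta ->
  forall w, (h w <= c_biconj c h w)%E.
Proof.
move=> [[[lf fNy]|->] cf] -> w; last by rewrite leNye.
rewrite leNgt; apply/negP => bf.
have [M bM Mf] : exists2 M : R, (c_biconj c (f \o theta) w < M%:E)%E &
    (M%:E < f (theta w))%E.
  move: bf => /=; case: (c_biconj _ _ _) => [b| |]; case: (f _) => [r| |] //.
  - by rewrite lte_fin => br; exists ((b + r) / 2); rewrite lte_fin; lra.
  - by exists (b + 1); rewrite ?ltry// lte_fin; lra.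
  - by exists (r - 1); rewrite ?ltNyr// lte_fin; lra.
  - by exists 0; rewrite ?ltNyr ?ltry.
have [l [s [l_lin l_cont lsf Mls]]] := affine_minorant cf lf fNy Mf.
have [y lE] := (XY_paired.1 l).1 (conj l_lin l_cont).
have gs : (c_conj c (f \o theta) y <= s%:E)%E.
  apply: ge_ereal_sup => _ [w' _ <-] /=.
  have := lsf (theta w'); rewrite /c /c_theta lE.
  case: (f _) => [r| |] //=; last by rewrite leNye.
  by rewrite !lee_fin; lra.
move: bM; apply/negP; rewrite -leNgt; apply: le_ereal_sup_tmp.
exists ((c w y)%:E - c_conj c (f \o theta) y)%E; first by exists y.
move: gs Mls; rewrite /c /c_theta lE; case: (c_conj _ _ _) => [r| |] //=.
- by rewrite !lee_fin; lra.
- by rewrite leey.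
Qed.

End paired_spaces.

Theorem proposition2p6 (R : realType) (X Y : tvsType R)
    (B : {bilinear X -> Y -> R | *%R & *%R}) (XY_paired : paired B)
    (W : Type) (theta : W -> X) (h : W -> \bar R) :
  let c := c_theta B theta in
  [/\ c_convex c h <->
        (exists f : X -> \bar R, closed_convex f /\ h = f \o theta),
      [<-> c_convex c h;
           h = c_biconj c h;
           h = star' B (c_conj c h) \o theta;
           exists f : X -> \bar R, closed_convex f /\ h = f \o theta]
    & closed_convex (star' B (c_conj c h))].
Proof.
move=> c.
have star_cc := star'_closed_convex XY_paired (c_conj c h).
have da : (exists f : X -> \bar R, closed_convex f /\ h = f \o theta) ->
    c_convex c h.
  move=> [f [fcc hf]]; apply/funext => w; apply/eqP; rewrite eq_le.
  by rewrite c_biconj_le (le_c_biconj XY_paired fcc hf).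
have ad : c_convex c h ->
    exists f : X -> \bar R, closed_convex f /\ h = f \o theta.
  by move=> hE; exists (star' B (c_conj c h)).
(* The first three statements are convertible: [c_biconj c h] unfolds to
   [star' B (c_conj c h) \o theta]. *)
split=> //; tfae=> //.
Qed.
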